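(* Let $\bar X=(\bar X_t)_{t\ge 0}$, $\bar Y=(\bar Y_t)_{t\ge 0}$ and $\bar Z=(\bar Z_t)_{t\ge 0}$ be time-homogeneous Markov chains with time indexed by $t=0,1,2,\dots$ and countable state spaces $A$, $B$ and $C$ respectively. Suppose that for maps $f:A\to C$ and $g:B\to C$, $$\bigl(f(\bar X_t)\bigr)_{t\ge 0}\overset{d}{=}\bar Z\overset{d}{=}\bigl(g(\bar Y_t)\bigr)_{t\ge 0}.$$ Then there exists a homogeneous Markov chain $(X_t,Y_t)_{t\ge 0}$ such that $(X_t)_{t\ge0}\overset{d}{=}\bar X$, $(Y_t)_{t\ge0}\overset{d}{=}\bar Y$, and $$f(X_t)=g(Y_t)\quad\text{for all } t\ge 0.$$ Moreover, writing $Z_t=f(X_t)=g(Y_t)$ (so that $Z=(Z_t)_{t\ge 0}\overset{d}{=}\bar Z$), the chain $(X_t,Y_t)_{t\ge0}$ may be chosen so that, in addition, the processes $X=(X_t)_{t\ge 0}$ and $Y=(Y_t)_{t\ge 0}$ are conditionally independent given the process $Z$.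
   Context: A Markov chain is regarded as a stochastic process with a specified initial distribution (the distribution of its state at time $0$) as well as its transition probabilities; $\overset{d}{=}$ denotes equality in law of processes. It is not assumed that $f(\bar X)$ or $g(\bar Y)$ would remain Markov if $\bar X$ or $\bar Y$ were started from other initial distributions. State spaces of Markov chains are always countable. *)

(* Defs.v *)
From HB Require Import structures.
From mathcomp Require Export all_boot all_order all_algebra.
From mathcomp Require Export all_classical all_reals all_analysis.

Set Implicit Arguments.
Unset Strict Implicit.
Unset Printing Implicit Defensive.

Import Order.TTheory GRing.Theory Num.Theory.
Local Open Scope classical_set_scope.
Local Open Scope ring_scope.

Section Processes.
Context {d : measure_display} {Omega : measurableType d} {R : realType}.

Definition trajectory {S : Type} (X : nat -> Omega -> S) (w : Omega) : nat -> S :=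
  fun t => X t w.

(* For countable [S] these sets generate the product, over all times, of the
   discrete sigma-algebras on [S]. *)
Definition coordinate_events (S : Type) : set (set (nat -> S)) :=
  [set E | exists (t : nat) (a : S), E = [set x : nat -> S | x t = a]].

Definition path_events (S : Type) : set (set (nat -> S)) :=
  <<s @coordinate_events S >>.

Definition is_process {S : countType} (X : nat -> Omega -> S) : Prop :=
  forall (t : nat) (a : S), measurable (X t @^-1` [set a]).

Definition process_sigma {S : countType} (X : nat -> Omega -> S) :
    set (set Omega) :=
  preimage_set_system setT (trajectory X) (@path_events S).

Definition elementary_cond_prob (P : probability Omega R) (E F : set Omega) : R :=
  fine (P (E `&` F)) / fine (P F).

Definition stochastic_matrix {S : countType} (p : S -> S -> R) : Prop :=
  (forall a b, 0 <= p a b) /\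
  (forall a, (\esum_(b in [set: S]) (p a b)%:E = 1)%E).

Definition history {S : Type} (X : nat -> Omega -> S) (t : nat) (x : nat -> S) :
    set Omega :=
  [set w | forall s, (s <= t)%N -> X s w = x s].

Definition homogeneous_markov_chain {S : countType} (P : probability Omega R)
    (X : nat -> Omega -> S) : Prop :=
  is_process X /\
  exists p : S -> S -> R, stochastic_matrix p /\
    forall (t : nat) (x : nat -> S) (b : S), P (history X t x) != 0%E ->
      elementary_cond_prob P (X t.+1 @^-1` [set b]) (history X t x) = p (x t) b.

(* [h] is a version of the conditional probability P(E | G). *)
Definition cond_prob_version (P : probability Omega R) (G : set (set Omega))
    (E : set Omega) (h : Omega -> R) : Prop :=
  [/\ forall B : set R, measurable B -> G (h @^-1` B),
      P.-integrable setT (EFin \o h)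
    & forall D, G D -> (\int[P]_(w in D) (h w)%:E = P (E `&` D))%E].

(* The requirement is P(E `&` F | Z) = P(E | Z) P(F | Z) almost surely. Versions
   are unique up to null sets, so it can be tested on one choice of versions;
   they are quantified existentially so that it can never hold vacuously. *)
Definition cond_independent_given {S1 S2 S3 : countType}
    (P : probability Omega R) (X : nat -> Omega -> S1) (Y : nat -> Omega -> S2)
    (Z : nat -> Omega -> S3) : Prop :=
  forall E F, process_sigma X E -> process_sigma Y F ->
    exists hE hF hEF : Omega -> R,
      [/\ cond_prob_version P (process_sigma Z) E hE,
          cond_prob_version P (process_sigma Z) F hF,
          cond_prob_version P (process_sigma Z) (E `&` F) hEF
        & {ae P, forall w, hEF w = hE w * hF w}].

End Processes.

(* The two processes may live on different probability spaces. *)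
Definition eq_law {R : realType} {d1 d2 : measure_display}
    {Omega1 : measurableType d1} {Omega2 : measurableType d2} {S : countType}
    (P1 : probability Omega1 R) (X1 : nat -> Omega1 -> S)
    (P2 : probability Omega2 R) (X2 : nat -> Omega2 -> S) : Prop :=
  forall E, path_events E ->
    P1 (trajectory X1 @^-1` E) = P2 (trajectory X2 @^-1` E).

(* Main.v *)
Require Import Defs.
From HB Require Import structures.
From mathcomp Require Import all_boot all_order all_algebra.
From mathcomp Require Import all_classical all_reals all_analysis.
From mathcomp Require Import measurable_realfun ring lra zify.

Set Implicit Arguments.
Unset Strict Implicit.
Unset Printing Implicit Defensive.
Import Order.TTheory GRing.Theory Num.Theory.
Local Open Scope classical_set_scope.
Local Open Scope ring_scope.

(** Why the theorem is true.  Take X and Y conditionally independent given the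
    common image process Z.  Write [k_E] for a version of P(X in E | Z), as a
    function on the paths of Z, write [k_F] for the same with Y, and let [zeta]
    be the law of Z.  The joint law is then forced to be
      P(X in E, Y in F) = int k_E k_F d zeta            ([glued_mass]),
    which also equals the integral of [k_F (f X)] over {X in E}, and the integral
    of [k_E (g Y)] over {Y in F}.  From the last two forms one reads off that the
    expression is sigma-additive in E for fixed F and in F for fixed E, and that
    its marginals are the laws of X and Y.  The functions [k_E] and [k_F] come
    from Radon-Nikodym densities, one event at a time.

    The one surprising point is that the pair (X, Y) is a homogeneous Markov
    chain.  The past of X is in general not independent of the future of Z
    given the past of Z, because f(X) need not be Markov under other starting
    distributions, so the coupling cannot be driven by the product of the two
    conditional kernels.  Instead, let a and b be words with the same image c,
    and condition each process on its initial word.  The laws of the futures of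
    X, Y and Z depend only on the last letters of a, b and c, and those of f(X)
    and g(Y) are absolutely continuous with respect to that of Z.  Hence
      P(X starts with a, Y starts with b)
        = P(a) P(b) / P(c) * K(last letter of a, last letter of b),
    where K is the integral, over the future of Z, of the product of the two
    densities.  One-step ratios of this formula depend only on the current pair
    of states and on the next one: the pair is an h-transform, with h = K, of
    the chain that moves with weights p(a, a') q(b, b') / r(c, c').  In the
    proof K stays implicit; [glued_mass_proportional] and [pair_mass_ratio] say
    that replacing the two words by others with the same last letters multiplies
    the joint mass by a constant.

    It remains to realise the joint masses of pairs of words by a process
    ([process_of_word_masses]).  This is done on the unit interval with uniform
    probability, by cutting it into nested half-open intervals indexed by words.
    Every prefix that this process follows has positive mass, whence
    f(X) = g(Y) everywhere and not just almost surely.  A pi-lambda argument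
    extends the joint law from cylinders to all pairs of path events
    ([joint_law]), and the densities [k_E] and [k_F] composed with Z are the
    conditional probabilities that conditional independence asks for. *)

(** * Path spaces and cylinders *)

(** A measurable type must be pointed, and the type of paths in a possibly empty
    countable type is not: hence the state [s0]. *)
Definition path_space (S : countType) (s0 : S) := nat -> S.

HB.instance Definition _ (S : countType) (s0 : S) :=
  Choice.copy (path_space s0) (nat -> S).
HB.instance Definition _ (S : countType) (s0 : S) :=
  isPointed.Build (path_space s0) (fun=> s0).
HB.instance Definition _ (S : countType) (s0 : S) :=
  @isMeasurable.Build (sigma_display (@coordinate_events S)) (path_space s0)
    <<s @coordinate_events S : set (set (path_space s0)) >>
    (@sigma_algebra0 _ setT _) (@sigma_algebraC (path_space s0) _)
    (@sigma_algebra_bigcup _ setT _).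

(** Words rather than a time and a reference path index the cylinders, so that
    extending a history by one step is [rcons]. *)
Definition cylinder (S : eqType) (w : seq S) : set (nat -> S) :=
  [set x | mkseq x (size w) = w].

Definition time_shift (S : Type) (n : nat) (x : nat -> S) : nat -> S :=
  fun t => x (n + t)%N.

Definition scons (S : Type) (a : S) (x : nat -> S) : nat -> S :=
  fun t => if t is t'.+1 then x t' else a.

Definition prepend (S : Type) (w : seq S) (x : nat -> S) : nat -> S :=
  foldr (@scons S) x w.

Definition lift_path (S T : Type) (f : S -> T) (x : nat -> S) : nat -> T :=
  fun t => f (x t).

Section Words.
Context {S : eqType}.
Implicit Types (w v : seq S) (x : nat -> S).

Lemma cylinder_nil : cylinder (@nil S) = setT.
Proof. by apply/seteqP; split. Qed.

Lemma mkseqD x n k : mkseq x (n + k) = mkseq x n ++ mkseq (time_shift n x) k.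
Proof.
rewrite /mkseq iotaD map_cat add0n -[X in iota X k](addn0 n) iotaDl -map_comp.
by [].
Qed.

Lemma cylinder_cat w v :
  cylinder (w ++ v) = cylinder w `&` time_shift (size w) @^-1` cylinder v.
Proof.
apply/seteqP; split=> x; rewrite /cylinder /= size_cat mkseqD.
  move/eqP; rewrite eqseq_cat ?size_mkseq// => /andP[/eqP -> /eqP ->].
  by split.
by move=> [-> ->].
Qed.

Lemma cylinder1 a : cylinder [:: a] = [set x : nat -> S | x 0%N = a].
Proof.
apply/seteqP; split=> x; rewrite /cylinder /mkseq /=; first by case.
by move=> ->.
Qed.

Lemma cylinder_rcons w a :
  cylinder (rcons w a) = cylinder w `&` [set x : nat -> S | x (size w) = a].
Proof.
rewrite -cats1 cylinder_cat cylinder1; congr (_ `&` _).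
by apply/seteqP; split=> x /=; rewrite /time_shift addn0.
Qed.

Lemma cylinder_disjoint w v : size w = size v -> w <> v ->
  cylinder w `&` cylinder v = set0.
Proof.
move=> s wv; apply/seteqP; split=> // x [].
by rewrite /cylinder/= s => -> /wv.
Qed.

Lemma cylinder_mkseq x n : cylinder (mkseq x n) x.
Proof. by rewrite /cylinder /= size_mkseq. Qed.

(** On the cylinder of a word, a path is a function of its tail, so every
    integrand can be rewritten as a function of the tail. *)
Lemma prepend_shift w x : cylinder w x -> prepend w (time_shift (size w) x) = x.
Proof.
elim: w x => [|a w IH] x /=; first by move=> _; apply/funext.
rewrite -[a :: w]cat1s cylinder_cat cylinder1 => -[/= x0 wx].
apply/funext => -[|t] //=.
have -> : time_shift (size w).+1 x = time_shift (size w) (time_shift 1 x) by apply/funext.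
by rewrite IH.
Qed.

End Words.

Section CylinderMap.
Context {S T : eqType} (f : S -> T).

Lemma cylinder_map w x : cylinder w x -> cylinder (map f w) (lift_path f x).
Proof. by rewrite /cylinder /= size_map => <-; rewrite size_mkseq /mkseq -map_comp. Qed.

End CylinderMap.

Lemma cylinder_pair (S T : eqType) (w : seq (S * T)) :
  cylinder w = lift_path fst @^-1` cylinder (unzip1 w) `&`
               lift_path snd @^-1` cylinder (unzip2 w).
Proof.
apply/seteqP; split => [x wx|x []].
  by split; apply: cylinder_map.
rewrite /preimage /cylinder /mkset !size_map => w1 w2.
rewrite -[LHS]zip_unzip -[RHS]zip_unzip -w1 -w2.
by rewrite /unzip1 /unzip2 /mkseq -!map_comp.
Qed.

Section PathSpace.
Context {S : countType} (s0 : S).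
Local Notation path := (path_space s0).

Lemma measurable_coordinate t a : @measurable _ path [set x : nat -> S | x t = a].
Proof. by apply: sub_sigma_algebra; exists t, a. Qed.

Lemma measurable_cylinder w : @measurable _ path (cylinder w).
Proof.
elim/last_ind: w => [|w a IH]; first by rewrite cylinder_nil.
by rewrite cylinder_rcons; apply: measurableI => //; exact: measurable_coordinate.
Qed.

Lemma measurable_to_path d (T : measurableType d) (phi : T -> nat -> S) :
  (forall t a, measurable [set x | phi x t = a]) ->
  measurable_fun setT (phi : T -> path).
Proof.
move=> mphi; apply: measurability => //.
by move=> _ [_ [t [a ->]] <-]; rewrite setTI; exact: mphi.
Qed.

Definition cylinders : set (set path) :=
  [set E | E = set0 \/ exists w : seq S, E = cylinder w].

(** Two cylinders are nested or disjoint, according to whether the shorter word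
    is a prefix of the longer one. *)
Lemma setI_cylinders : setI_closed cylinders.
Proof.
suff wlg w v : (size w <= size v)%N -> cylinders (cylinder w `&` cylinder v).
  move=> E F [->|[w ->]]; first by rewrite set0I; left.
  move=> [->|[v ->]]; first by rewrite setI0; left.
  by case: (leqP (size w) (size v)) => [/wlg//|/ltnW/wlg]; rewrite setIC.
move=> wv; have := size_takel wv; rewrite -{2}(cat_take_drop (size w) v).
move: (take _ _) (drop _ _) => v1 v2 v1w; have [->|/eqP ne] := eqVneq v1 w.
  by right; exists (w ++ v2); rewrite cylinder_cat setIA setIid.
left; rewrite cylinder_cat setIA cylinder_disjoint ?set0I//.
by move=> /esym.
Qed.

Lemma generated_by_cylinders : @measurable _ path = <<s cylinders >>.
Proof.
apply/seteqP; split.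
  apply: smallest_sub; first exact: smallest_sigma_algebra.
  move=> _ [t [a ->]].
  have -> : [set x : nat -> S | x t = a] =
      \bigcup_(w in [set: seq S]) (if size w == t then cylinder (rcons w a) else set0).
    apply/seteqP; split => x /=.
      move=> xt; exists (mkseq x t) => //; rewrite size_mkseq eqxx cylinder_rcons.
      by split; [exact: cylinder_mkseq | rewrite /= size_mkseq].
    move=> [w _]; case: eqP => // <-.
    by rewrite cylinder_rcons => -[].
  apply: (@countable_bigcupT_measurable _ (g_sigma_algebraType cylinders)) => // w.
  case: ifP => _; first by apply: sub_sigma_algebra; right; exists (rcons w a).
  by apply: sub_sigma_algebra; left.
apply: smallest_sub; first exact: smallest_sigma_algebra.
by move=> _ [->|[w ->]]; [exact: measurable0 | exact: measurable_cylinder].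
Qed.

(** The uniqueness half of every extension argument below: cylinders form a
    generating pi-system that contains the whole space. *)
Lemma path_measure_unique (R : realType) (mu nu : {measure set path -> \bar R}) :
  (mu setT < +oo)%E -> (forall w : seq S, mu (cylinder w) = nu (cylinder w)) ->
  forall E, measurable E -> mu E = nu E.
Proof.
move=> muT muw E mE.
apply: (measure_unique cylinders (fun=> setT)) => //.
- exact: generated_by_cylinders.
- exact: setI_cylinders.
- by move=> _; right; exists [::]; rewrite cylinder_nil.
- by rewrite bigcup_const//; exists 0%N.
- by move=> _ [->|[w ->]]; rewrite ?measure0.
Qed.

Lemma measurable_time_shift n : measurable_fun setT (time_shift n : path -> path).
Proof. by apply: measurable_to_path => t a; exact: measurable_coordinate. Qed.

Lemma measurable_prepend w : measurable_fun setT (prepend w : path -> path).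
Proof.
apply: measurable_to_path; elim: w => [|b w IH] t a /=.
  exact: measurable_coordinate.
case: t => [|t]; last exact: IH.
have [->|ba] := eqVneq b a.
  by rewrite (_ : mkset _ = setT)//; apply/seteqP; split.
by rewrite (_ : mkset _ = set0)//; apply/seteqP; split => // x /= /eqP; rewrite (negbTE ba).
Qed.

End PathSpace.

Lemma esum_enumeration (S : countType) (R : realType) (c : S -> \bar R) :
  (forall s, 0 <= c s)%E ->
  (\esum_(s in [set: S]) c s = \sum_(n <oo) oapp c 0 (pickle_inv n))%E.
Proof.
move=> c0; rewrite nneseries_esumT; last by move=> n; case: pickle_inv => [s|] /=.
transitivity (\esum_(n in pickle @` [set: S]) oapp c 0 (pickle_inv n))%E.
  rewrite esum_image; last by move=> ? ? _ _; exact: (pcan_inj pickleK).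
  by apply: eq_esum => s _; rewrite pickleK_inv.
rewrite (esum_mkcond (pickle @` _)); apply: eq_esum => n _.
case: ifPn => // /negP nn.
case En : (pickle_inv n) => [s|//]; exfalso; apply: nn; rewrite inE /=; exists s => //.
by have := @pickle_invK S n; rewrite /ocancel En.
Qed.

Section MeasurableFibres.
Context d (T : measurableType d) (S : countType).

Lemma measurable_countable_preimage (V : T -> S) (Q : set S) :
  (forall s, measurable (V @^-1` [set s])) -> measurable (V @^-1` Q).
Proof.
move=> mV; rewrite (_ : V @^-1` Q = \bigcup_s (if s \in Q then V @^-1` [set s] else set0)).
  by apply: countable_bigcupT_measurable => // s; case: ifP.
apply/seteqP; split=> x /=; first by move=> Qx; exists (V x) => //; rewrite mem_set.
by move=> [s _]; case: ifPn => //; rewrite inE => Qs /= ->.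
Qed.

Lemma measure_fibres (R : realType) (mu : {measure set T -> \bar R}) (V : T -> S)
    (E : set T) :
  (forall s, measurable (V @^-1` [set s])) -> measurable E ->
  mu E = \esum_(s in [set: S]) mu (E `&` V @^-1` [set s]).
Proof.
move=> mV mE.
pose F n := oapp (fun s => E `&` V @^-1` [set s]) set0 (pickle_inv n).
have mF n : measurable (F n).
  by rewrite /F; case: pickle_inv => [s|] //=; exact: measurableI.
have EF : E = \bigcup_n F n.
  apply/seteqP; split=> x /=.
    by move=> Ex; exists (pickle (V x)) => //; rewrite /F pickleK_inv.
  by move=> [n _]; rewrite /F; case: pickle_inv => // s [].
have tF : trivIset setT F.
  move=> i j _ _ [x []]; rewrite /F.
  case Ei : (pickle_inv i) => [s|//]; case Ej : (pickle_inv j) => [s'|//].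
  move=> [_ /= Vs] [_ /= Vs'].
  have := @pickle_invK S i; have := @pickle_invK S j.
  by rewrite /ocancel Ei Ej /= -Vs -Vs' => <- <-.
rewrite [in LHS]EF measure_bigcup// nneseries_esum// set_mem_set -nneseries_esumT//.
rewrite esum_enumeration//.
by apply: eq_eseriesr => n _; rewrite /F; case: pickle_inv => [s|] //=; rewrite measure0.
Qed.

End MeasurableFibres.

Section MeasurableMap.
Context {S T : countType} (s0 : S) (t0 : T) (f : S -> T).

Lemma measurable_lift_path :
  measurable_fun setT (lift_path f : path_space s0 -> path_space t0).
Proof.
apply: measurable_to_path => t a.
apply: (measurable_countable_preimage (V := fun x : path_space s0 => x t) (f @^-1` [set a])).
by move=> s; exact: measurable_coordinate.
Qed.

End MeasurableMap.

(** * Densities *)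

(** For two measures carried to the same space by maps, each after restriction
    to an event, densities are handled through the functionals that integrate
    functions of that space. *)
Definition push_integral d (T : measurableType d) (R : realType)
    (U : Type) (mu : set T -> \bar R) (E : set T) (phi : T -> U)
    (h : U -> \bar R) : \bar R :=
  (\int[mu]_(x in E) h (phi x))%E.

(** The defining equation of a Radon-Nikodym derivative, tested on all
    nonnegative functions.  It makes sense for arbitrary functionals, which
    spares naming the restricted and transported measures. *)
Definition is_density d (U : measurableType d) (R : realType)
    (I J : (U -> \bar R) -> \bar R) (k : U -> R) : Prop :=
  [/\ measurable_fun setT k, forall u, 0 <= k u
    & forall h : U -> \bar R, measurable_fun setT h -> (forall u, 0 <= h u)%E ->
        I h = J (fun u => h u * (k u)%:E)%E].

Section RestrictedPushforward.
Context d1 d2 (T : measurableType d1) (U : measurableType d2) (R : realType).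
Variables (mu : {finite_measure set T -> \bar R}) (E : set T) (mE : measurable E).
Variables (phi : T -> U) (mphi : measurable_fun setT phi).

Definition restricted_pushforward of measurable E & measurable_fun setT phi :=
  fun D : set U => mu (E `&` phi @^-1` D).

Local Notation law := (restricted_pushforward mE mphi).

Let mpre D : measurable D -> measurable (E `&` phi @^-1` D).
Proof. by move=> mD; apply: measurableI => //; rewrite -[X in measurable X]setTI; exact: mphi. Qed.

Let law0 : law set0 = 0%E.
Proof. by rewrite /restricted_pushforward preimage_set0 setI0 measure0. Qed.

Let law_ge0 D : (0 <= law D)%E.
Proof. exact: measure_ge0. Qed.

Let law_sigma_additive : semi_sigma_additive law.
Proof.
move=> F mF tF mUF; rewrite /restricted_pushforward preimage_bigcup setI_bigcupr.
apply: measure_semi_sigma_additive.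
- by move=> n; exact: mpre.
- apply/trivIsetP => i j _ _ ij; rewrite -setIIr -preimage_setI.
  by move/trivIsetP : tF => ->//; rewrite preimage_set0 setI0.
- by apply: bigcup_measurable => n _; exact: mpre.
Qed.

HB.instance Definition _ :=
  isMeasure.Build _ _ _ law law0 law_ge0 law_sigma_additive.

Let law_finite : fin_num_fun law.
Proof. by move=> D mD; apply: fin_num_measure; exact: mpre. Qed.

HB.instance Definition _ := @Measure_isFinite.Build _ _ _ law law_finite.

Lemma integral_restricted_pushforward (h : U -> \bar R) :
  measurable_fun setT h -> (forall u, 0 <= h u)%E ->
  (\int[law]_u h u = push_integral mu E phi h)%E.
Proof.
move=> mh h0.
pose m := mrestr mu mE.
transitivity (\int[pushforward m phi]_u h u)%E.
  apply: eq_measure_integral => D mD _.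
  by rewrite /= /restricted_pushforward /pushforward /m /mrestr setIC.
rewrite ge0_integral_pushforward// preimage_setT.
have mhphi : measurable_fun setT (h \o phi) by exact: measurableT_comp.
rewrite -(setUv E) ge0_integral_setU//; first last.
- by rewrite disj_set2E setICr.
- by move=> x _; exact: h0.
- by apply: measurable_funS mhphi.
- exact: measurableC.
rewrite [X in (_ + X)%E]null_set_integral ?adde0; first last.
- by rewrite /= /mrestr setICl measure0.
- by apply: measurable_funS mhphi.
- exact: measurableC.
apply: eq_measure_integral => D mD DE.
by rewrite /= /mrestr setIidl.
Qed.

End RestrictedPushforward.

Section Densities.
Context d1 d2 d3 (T : measurableType d1) (W : measurableType d2)
  (U : measurableType d3) (R : realType).

(** Radon-Nikodym: the domination hypothesis compares the two transported
    restrictions, and gives absolute continuity. *)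
Lemma density_exists (mu : {finite_measure set T -> \bar R})
  (zeta : {finite_measure set W -> \bar R}) (E : set T) (G : set W)
  (phi : T -> U) (chi : W -> U) :
  measurable E -> measurable G ->
  measurable_fun setT phi -> measurable_fun setT chi ->
  (forall D, measurable D -> mu (E `&` phi @^-1` D) <= zeta (G `&` chi @^-1` D))%E ->
  exists k, is_density (push_integral mu E phi) (push_integral zeta G chi) k.
Proof.
move=> mE mG mphi mchi le.
set l1 : {finite_measure set U -> \bar R} := restricted_pushforward mu mE mphi.
set l2 : {finite_measure set U -> \bar R} := restricted_pushforward zeta mG mchi.
have l12 : l1 `<< l2.
  apply/null_content_dominatesP => D mD l2D.
  by apply/eqP; rewrite eq_le measure_ge0 andbT -l2D; exact: le.
pose f := Radon_Nikodym_SigmaFinite.f l1 l2.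
have mf : measurable_fun setT f.
  by apply: (measurable_int l2); exact: Radon_Nikodym_SigmaFinite.f_integrable.
have f0 := Radon_Nikodym_SigmaFinite.f_ge0 l12.
exists (fine \o f); split.
- exact: measurableT_comp.
- by move=> u; exact: fine_ge0.
move=> h mh h0; have fE u : (fine (f u))%:E = f u.
  by rewrite fineK//; exact: Radon_Nikodym_SigmaFinite.f_fin_num.
rewrite -(integral_restricted_pushforward _ mE mphi)//.
rewrite -(Radon_Nikodym_SigmaFinite.change_of_variables l12)//.
under eq_integral do rewrite -/f -fE.
rewrite integral_restricted_pushforward//.
- apply: emeasurable_funM => //.
  by under eq_fun do rewrite fE.
- by move=> u; rewrite mule_ge0// lee_fin fine_ge0.
Qed.

End Densities.

Section DensityMeasure.
Context d (T : measurableType d) (R : realType).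
Variables (mu : {measure set T -> \bar R}) (k : T -> R).
Hypotheses (mk : measurable_fun setT k) (k0 : forall x, 0 <= k x).

Definition density_measure of measurable_fun setT k & (forall x, 0 <= k x) :=
  fun E : set T => (\int[mu]_(x in E) (k x)%:E)%E.

Local Notation m := (density_measure mk k0).

Let m0 : m set0 = 0%E. Proof. exact: integral_set0. Qed.

Let m_ge0 E : (0 <= m E)%E.
Proof. by apply: integral_ge0 => x _; rewrite lee_fin. Qed.

Let m_sigma_additive : semi_sigma_additive m.
Proof.
move=> F mF tF mUF; rewrite /density_measure; apply: cvg_toP.
  apply: ereal_nondecreasing_is_cvgn => i j ij.
  by apply: lee_sum_nneg_natr => // n _ _; exact: m_ge0.
rewrite ge0_integral_bigcup//=.
- by apply: measurable_funTS; exact/measurable_EFinP.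
- by move=> x _; rewrite lee_fin.
Qed.

HB.instance Definition _ := isMeasure.Build _ _ _ m m0 m_ge0 m_sigma_additive.

End DensityMeasure.

(** * Conditional probabilities given the image process *)
Section ConditionalProbability.
Context d1 d2 (T : measurableType d1) (U : measurableType d2) (R : realType).
Variables (mu : {finite_measure set T -> \bar R})
  (zeta : {finite_measure set U -> \bar R}).
Variables (phi : T -> U) (mphi : measurable_fun setT phi).
Hypothesis law_phi : forall D, measurable D -> mu (phi @^-1` D) = zeta D.

(** [k] is a version of the conditional probability of [E] given [phi], seen as
    a function on the target of [phi]. *)
Definition is_cond_prob (E : set T) (k : U -> R) : Prop :=
  is_density (push_integral mu E phi) (push_integral zeta setT id) k.

Definition cond_prob (E : set T) : U -> R := xget (fun=> 0) (is_cond_prob E).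

Lemma measurable_preimage D : measurable D -> measurable (phi @^-1` D).
Proof. by move=> mD; rewrite -[X in measurable X]setTI; exact: mphi. Qed.

Lemma cond_probP E : measurable E -> is_cond_prob E (cond_prob E).
Proof.
move=> mE; rewrite /cond_prob; case: xgetP => [k _ //|no].
have [k kP] : exists k, is_cond_prob E k; last by case: (no k).
apply: density_exists => // D mD; rewrite setTI -law_phi//.
apply: le_measure; rewrite ?inE//; first by apply: measurableI => //; exact: measurable_preimage.
exact: measurable_preimage.
Qed.

Lemma measurable_cond_prob E : measurable E -> measurable_fun setT (cond_prob E).
Proof. by move=> /cond_probP[]. Qed.

Lemma cond_prob_ge0 E u : measurable E -> 0 <= cond_prob E u.
Proof. by move=> /cond_probP[]. Qed.

Lemma integral_cond_prob E (h : U -> \bar R) : measurable E ->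
  measurable_fun setT h -> (forall u, 0 <= h u)%E ->
  (\int[mu]_(x in E) h (phi x) = \int[zeta]_u (h u * (cond_prob E u)%:E))%E.
Proof. by move=> /cond_probP[_ _]; apply. Qed.

(** An event contained in the preimage of [D] has conditional probability zero
    off [D], so a version may be cut down to [D]. *)
Lemma is_cond_prob_restr E D (k : U -> R) : measurable D ->
  is_cond_prob E k -> E `<=` phi @^-1` D -> is_cond_prob E (fun u => \1_D u * k u).
Proof.
move=> mD [mk k0 kP] ED; split.
- by apply: measurable_funM => //.
- by move=> u; rewrite mulr_ge0// indicE.
move=> h mh h0.
have -> : push_integral mu E phi h =
    push_integral mu E phi (fun u => h u * (\1_D u)%:E)%E.
  apply: eq_integral => x; rewrite inE => /ED Dx.
  by rewrite indicE mem_set// mule1.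
rewrite kP.
- by apply: eq_integral => u _; rewrite EFinM muleA.
- by apply: emeasurable_funM => //; exact/measurable_EFinP.
- by move=> u; rewrite mule_ge0// lee_fin indicE.
Qed.

Lemma integral_cond_prob_set E D : measurable E -> measurable D ->
  (\int[zeta]_(u in D) (cond_prob E u)%:E = mu (E `&` phi @^-1` D))%E.
Proof.
move=> mE mD.
rewrite integral_mkcond setIC -integral_indic//; last exact: measurable_preimage.
transitivity (\int[mu]_(x in E) (\1_D (phi x))%:E)%E; last by [].
rewrite (@integral_cond_prob E (fun u => (\1_D u)%:E))//.
  apply: eq_integral => u _; rewrite patchE indicE.
  by case: (u \in D); rewrite ?mul1e ?mul0e.
exact/measurable_EFinP.
Qed.

Lemma is_cond_prob_setT : is_cond_prob setT (fun=> 1).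
Proof.
split=> // h mh h0; under [RHS]eq_integral do rewrite mule1.
transitivity (\int[pushforward mu phi]_u h u)%E.
  by rewrite ge0_integral_pushforward.
by apply: eq_measure_integral => D mD _; exact: law_phi.
Qed.

End ConditionalProbability.

(** * The conditionally independent joint law *)
Section Gluing.
Context d1 d2 d3 (T1 : measurableType d1) (T2 : measurableType d2)
  (U : measurableType d3) (R : realType).
Variables (mu : {finite_measure set T1 -> \bar R})
  (nu : {finite_measure set T2 -> \bar R})
  (zeta : {finite_measure set U -> \bar R}).
Variables (phi : T1 -> U) (psi : T2 -> U).
Hypotheses (mphi : measurable_fun setT phi) (mpsi : measurable_fun setT psi).
Hypothesis law_phi : forall D, measurable D -> mu (phi @^-1` D) = zeta D.
Hypothesis law_psi : forall D, measurable D -> nu (psi @^-1` D) = zeta D.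

(** The mass that [E] and [F] must jointly have if the two processes are
    conditionally independent given their common image. *)
Definition glued_mass (E : set T1) (F : set T2) : \bar R :=
  (\int[mu]_(x in E) (cond_prob nu zeta psi F (phi x))%:E)%E.

Local Notation kmu := (cond_prob mu zeta phi).
Local Notation knu := (cond_prob nu zeta psi).

Let kmu0 E u : measurable E -> 0 <= kmu E u.
Proof. exact: cond_prob_ge0. Qed.

Let knu0 F u : measurable F -> 0 <= knu F u.
Proof. exact: cond_prob_ge0. Qed.

Let mkmu E : measurable E -> measurable_fun setT (kmu E).
Proof. exact: measurable_cond_prob. Qed.

Let mknu F : measurable F -> measurable_fun setT (knu F).
Proof. exact: measurable_cond_prob. Qed.

Lemma glued_massE E F : measurable E -> measurable F ->
  (glued_mass E F = \int[zeta]_u ((kmu E u)%:E * (knu F u)%:E))%E.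
Proof.
move=> mE mF.
apply: etrans (integral_cond_prob mphi law_phi mE (h := EFin \o knu F) _ _) _.
- by apply/measurable_EFinP; exact: mknu.
- by move=> u; rewrite lee_fin knu0.
- by apply: eq_integral => u _; rewrite /= muleC.
Qed.

(** The symmetry of [glued_massE] in disguise; it is what makes the joint mass
    sigma-additive in the second event too, although the chosen versions
    [cond_prob] are additive almost everywhere only. *)
Lemma glued_mass_sym E F : measurable E -> measurable F ->
  (glued_mass E F = \int[nu]_(y in F) (kmu E (psi y))%:E)%E.
Proof.
move=> mE mF; rewrite glued_massE//.
rewrite (integral_cond_prob mpsi law_psi mF (h := EFin \o kmu E))//.
- by apply/measurable_EFinP; exact: mkmu.
- by move=> u; rewrite lee_fin kmu0.
Qed.

(** Versions of a conditional probability differ on null sets only, which the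
    integral against the first law does not see. *)
Lemma glued_mass_density E F k : measurable E -> measurable F ->
  is_cond_prob nu zeta psi F k ->
  glued_mass E F = (\int[mu]_(x in E) (k (phi x))%:E)%E.
Proof.
move=> mE mF [mk k0 kP].
rewrite (integral_cond_prob mphi law_phi mE (h := EFin \o k))//; first last.
- exact/measurable_EFinP.
rewrite glued_mass_sym// -[LHS]/(push_integral nu F psi (EFin \o kmu E)) kP//.
- by apply: eq_integral => u _; rewrite /= muleC.
- by apply/measurable_EFinP; exact: mkmu.
- by move=> u; rewrite lee_fin kmu0.
Qed.

Lemma glued_mass_ge0 E F : measurable F -> (0 <= glued_mass E F)%E.
Proof. by move=> mF; apply: integral_ge0 => x _; rewrite lee_fin knu0. Qed.

Lemma glued_mass_setTr E : measurable E -> glued_mass E setT = mu E.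
Proof.
move=> mE; rewrite (glued_mass_density mE measurableT (is_cond_prob_setT mpsi law_psi)).
by rewrite integral_cst// mul1e.
Qed.

Lemma glued_mass_disjoint E F D1 D2 : measurable E -> measurable F -> measurable D2 ->
  E `<=` phi @^-1` D1 -> F `<=` psi @^-1` D2 -> D1 `&` D2 = set0 ->
  glued_mass E F = 0%E.
Proof.
move=> mE mF mD2 ED1 FD2 D12.
have kP := is_cond_prob_restr mD2 (cond_probP mpsi law_psi mF) FD2.
rewrite (glued_mass_density mE mF kP); apply: integral0_eq => x Ex.
rewrite indicE memNset ?mul0r// => D2x.
by have : (D1 `&` D2) (phi x); [split => //; exact: ED1 | rewrite D12].
Qed.

Lemma glued_mass_measure_l F : measurable F ->
  exists m : {measure set T1 -> \bar R}, forall E, m E = glued_mass E F.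
Proof.
move=> mF.
have mk : measurable_fun setT (knu F \o phi) by apply: measurableT_comp mphi; exact: mknu.
have k0 x : 0 <= (knu F \o phi) x by exact: knu0.
by exists (density_measure mu mk k0).
Qed.

(** Intersecting with an event of the image process restricts the integral of
    the product of densities: this is conditional independence in integrated
    form. *)
Lemma glued_mass_fibre E F D : measurable E -> measurable F -> measurable D ->
  glued_mass (E `&` phi @^-1` D) F = (\int[zeta]_(u in D) (kmu E u * knu F u)%:E)%E.
Proof.
move=> mE mF mD.
have mphiD := measurable_preimage mphi mD.
rewrite /glued_mass integral_mkcondr.
transitivity (\int[mu]_(x in E) (\1_D (phi x) * knu F (phi x))%:E)%E.
  apply: eq_integral => x _; rewrite patchE indicE.
  have -> : (x \in phi @^-1` D) = (phi x \in D) by apply/idP/idP; rewrite !inE.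
  by case: (phi x \in D); rewrite ?mul1r ?mul0r.
apply: etrans (integral_cond_prob mphi law_phi mE
  (h := fun u => (\1_D u * knu F u)%:E) _ _) _.
- by apply/measurable_EFinP/measurable_funM => //; exact: mknu.
- by move=> u; rewrite lee_fin mulr_ge0 ?knu0// indicE.
- rewrite [RHS]integral_mkcond; apply: eq_integral => u _; rewrite patchE indicE.
  by case: (u \in D); rewrite ?mul1r ?mul0r ?mul0e// muleC EFinM.
Qed.

End Gluing.

Section GluingSymmetric.
Context d1 d2 d3 (T1 : measurableType d1) (T2 : measurableType d2)
  (U : measurableType d3) (R : realType).
Variables (mu : {finite_measure set T1 -> \bar R})
  (nu : {finite_measure set T2 -> \bar R})
  (zeta : {finite_measure set U -> \bar R}).
Variables (phi : T1 -> U) (psi : T2 -> U).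
Hypotheses (mphi : measurable_fun setT phi) (mpsi : measurable_fun setT psi).
Hypothesis law_phi : forall D, measurable D -> mu (phi @^-1` D) = zeta D.
Hypothesis law_psi : forall D, measurable D -> nu (psi @^-1` D) = zeta D.

Local Notation glued_mass := (glued_mass mu nu zeta phi psi).

Lemma glued_mass_setTl F : measurable F -> glued_mass setT F = nu F.
Proof.
move=> mF; rewrite glued_mass_sym//.
exact: (glued_mass_setTr mpsi mphi law_psi law_phi).
Qed.

Lemma glued_mass_measure_r E : measurable E ->
  exists m : {measure set T2 -> \bar R}, forall F, measurable F -> m F = glued_mass E F.
Proof.
move=> mE; have [m mP] := glued_mass_measure_l nu mpsi mphi law_phi mE.
by exists m => F mF; rewrite mP (glued_mass_sym mphi mpsi).
Qed.

Lemma glued_mass_le_l E F : measurable E -> measurable F -> (glued_mass E F <= mu E)%E.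
Proof.
move=> mE mF; have [M MP] := glued_mass_measure_r mE.
rewrite -[leRHS](glued_mass_setTr mphi mpsi law_phi law_psi mE).
rewrite -(MP _ mF) -(MP _ measurableT).
by apply: le_measure; rewrite ?inE.
Qed.

Lemma glued_mass_le_r E F : measurable E -> measurable F -> (glued_mass E F <= nu F)%E.
Proof.
move=> mE mF; have [M MP] := glued_mass_measure_l mu mphi mpsi law_psi mF.
rewrite -[leRHS](glued_mass_setTl mF) -!MP.
by apply: le_measure; rewrite ?inE.
Qed.

Lemma glued_mass_fin E F : measurable E -> measurable F ->
  glued_mass E F \is a fin_num.
Proof.
move=> mE mF; rewrite ge0_fin_numE; last exact: glued_mass_ge0.
by rewrite (le_lt_trans (glued_mass_le_l mE mF))// -ge0_fin_numE// fin_num_measure.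
Qed.

End GluingSymmetric.

(** * A process on the unit interval with given word masses *)
Section ProcessOfWordMasses.
Context (S : countType) (R : realType).
Variable m : seq S -> R.
Hypotheses (m_ge0 : forall w, 0 <= m w) (m_nil : m [::] = 1).
Hypothesis m_rcons : forall w,
  (\esum_(s in [set: S]) (m (rcons w s))%:E = (m w)%:E)%E.

Let coef w n := oapp (fun s => m (rcons w s)) 0 (pickle_inv n).
Let partial w n := \sum_(k < n) coef w k.

Let coef_pickle w s : coef w (pickle s) = m (rcons w s).
Proof. by rewrite /coef pickleK_inv. Qed.

Let coef_ge0 w n : 0 <= coef w n.
Proof. by rewrite /coef; case: pickle_inv => [s|] /=. Qed.

Let coef_series w : (\sum_(n <oo) (coef w n)%:E = (m w)%:E)%E.
Proof.
rewrite -m_rcons esum_enumeration; last by move=> s; rewrite lee_fin.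
by apply: eq_eseriesr => n _; rewrite /coef; case: pickle_inv.
Qed.

Let partialE w n : ((partial w n)%:E = \sum_(0 <= k < n) (coef w k)%:E)%E.
Proof. by rewrite big_mkord sumEFin. Qed.

Let partial_le w n : partial w n <= m w.
Proof.
rewrite -lee_fin partialE -coef_series.
by apply: nneseries_lim_ge => k _; rewrite lee_fin.
Qed.

Let partialS w n : partial w n.+1 = partial w n + coef w n.
Proof. by rewrite /partial big_ord_recr. Qed.

Let partial_mono w i j : (i <= j)%N -> partial w i <= partial w j.
Proof.
move=> /subnK <-; elim: (j - i)%N => // k IH.
by rewrite addSn partialS (le_trans IH)// lerDl.
Qed.

(** Strict inequality is what half-open intervals need: a point strictly to the
    left of the total is already passed by a finite partial sum. *)
Let partial_gt w y : y < m w -> exists n, y < partial w n.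
Proof.
move=> ym; apply: contrapT => /forallNP no.
suff : ((m w)%:E <= y%:E)%E by rewrite lee_fin leNgt ym.
rewrite -coef_series; apply: lime_le.
  by apply: is_cvg_nneseries => n _ _; rewrite lee_fin.
by apply: nearW => n; rewrite -partialE lee_fin leNgt; exact/negP.
Qed.

(** The children of a word fill its interval from left to right, in the order of
    the enumeration of [S]. *)
Definition left_end (w : seq S) : R :=
  (foldl (fun p s => (rcons p.1 s, p.2 + partial p.1 (pickle s))) ([::], 0) w).2.

Let left_end_rcons w s :
  left_end (rcons w s) = left_end w + partial w (pickle s).
Proof.
rewrite /left_end foldl_rcons /=; congr (_ + partial _ _).
by elim/last_ind: w => // w b IH; rewrite foldl_rcons /= IH.
Qed.

Definition word_interval (w : seq S) : set R :=
  [set x | left_end w <= x < left_end w + m w].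

Let interval_nil : word_interval [::] = [set x | 0 <= x < 1].
Proof. by rewrite /word_interval m_nil add0r. Qed.

Let interval_rcons w s : word_interval (rcons w s) `<=` word_interval w.
Proof.
move=> x; rewrite /word_interval /= left_end_rcons => /andP[lx xr].
have := partial_le w (pickle s).+1; rewrite partialS coef_pickle => le.
have : 0 <= partial w (pickle s) by apply: sumr_ge0 => i _; exact: coef_ge0.
by rewrite /word_interval /=; move: lx xr le; set p := partial _ _; lra.
Qed.

Let interval_inj w s s' x :
  word_interval (rcons w s) x -> word_interval (rcons w s') x -> s = s'.
Proof.
wlog lt : s s' / (pickle s < pickle s')%N.
  move=> H; case: (ltngtP (pickle s) (pickle s')) => [/H//|lt x1 x2|].
    by apply/esym; exact: (H s' s lt).
  by move=> /(pcan_inj pickleK).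
rewrite /word_interval/= !left_end_rcons => /andP[_ xr] /andP[lx _].
have := partial_mono w lt; rewrite partialS coef_pickle.
by move=> le; exfalso; lra.
Qed.

Let interval_split w x : word_interval w x ->
  exists s, word_interval (rcons w s) x.
Proof.
move=> /andP[lx xr].
have ex : exists n, x - left_end w < partial w n by apply: partial_gt; lra.
case: (ex_minnP ex) => -[|n].
  by rewrite /partial big_ord0 => h; exfalso; lra.
move=> lt min.
have le : partial w n <= x - left_end w.
  by rewrite leNgt; apply/negP => /min; rewrite ltnn.
move: lt; rewrite partialS /coef.
have := @pickle_invK S n; rewrite /ocancel.
case: (pickle_inv n) => [s /= sn|_ /=] lt; last by exfalso; lra.
by exists s; rewrite /word_interval /= left_end_rcons sn; lra.
Qed.

(** A point of the unit interval lies in exactly one word interval of each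
    length, and these words are nested, so it determines a path.  A word of mass
    zero has an empty interval, hence is never followed. *)
Lemma process_of_word_masses :
  exists (d : measure_display) (Omega : measurableType d)
         (P : probability Omega R) (V : nat -> Omega -> S),
    [/\ forall w, measurable (trajectory V @^-1` cylinder w),
        forall w, P (trajectory V @^-1` cylinder w) = (m w)%:E
      & forall x n, 0 < m (mkseq (V^~ x) n)].
Proof.
have [s0 _] : exists s, word_interval (rcons [::] s) 0.
  by apply: interval_split; rewrite interval_nil /= lexx ltr01.
have [next nextP] : {next : seq S * R -> S & forall p,
    word_interval p.1 p.2 -> word_interval (rcons p.1 (next p)) p.2}.
  apply: (choice (P := fun p s => word_interval p.1 p.2 ->
    word_interval (rcons p.1 s) p.2)) => -[w x] /=; have [wx|nwx] := pselect (word_interval w x).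
    by have [s] := interval_split wx; exists s.
  by exists s0.
pose word x := fix F n := if n is n'.+1 then rcons (F n') (next (F n', x)) else [::].
(* Points outside the unit interval follow the path of the origin, so that the
   positivity of the masses of all prefixes holds at every sample point. *)
pose r (x : R) := if (0 <= x) && (x < 1) then x else 0.
have r01 x : word_interval [::] (r x).
  by rewrite interval_nil /r /=; case: ifP => //; rewrite lexx ltr01.
have wordP x n : word_interval [::] x -> word_interval (word x n) x.
  by move=> x01; elim: n => // n IH; exact: (nextP (_, _)).
have word_uniq x w : word_interval w x -> word x (size w) = w.
  elim/last_ind: w => // w s IH wsx; rewrite size_rcons /=.
  have wx := interval_rcons wsx; rewrite IH//; congr rcons.
  by apply: interval_inj wsx; exact: (nextP (w, x)).
pose V t x := next (word (r x) t, r x).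
have VE x n : mkseq (V^~ x) n = word (r x) n.
  elim: n => // n IH; rewrite /mkseq -addn1 iotaD map_cat.
  by rewrite -/(mkseq _ _) IH /= add0n cats1 addn1.
have cylE w : [set x : R | cylinder w (V^~ x)] = r @^-1` word_interval w.
  apply/seteqP; split => x; rewrite /cylinder /= VE.
    by move=> e; rewrite -[X in word_interval X]e; exact: wordP.
  exact: word_uniq.
have itvE w : word_interval w = `[left_end w, left_end w + m w[%classic.
  by apply/seteqP; split => x; rewrite /= in_itv.
have mI w : measurable (word_interval w) by rewrite itvE; exact: measurable_itv.
have rE w : r @^-1` word_interval w =
    word_interval w `|` (if `[<word_interval w 0>] then ~` word_interval [::] else set0).
  have sub : word_interval w `<=` word_interval [::].
    elim/last_ind: w {VE} => // w s IH.
    by apply: subset_trans IH; exact: interval_rcons.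
  have r_in x : word_interval [::] x -> r x = x.
    by rewrite interval_nil /r => /= ->.
  have r_out x : ~ word_interval [::] x -> r x = 0.
    by rewrite interval_nil /r => /= /negP/negbTE ->.
  apply/seteqP; split => x /=.
    have [x01|x01] := pselect (word_interval [::] x); first by rewrite r_in//; left.
    by rewrite r_out// => w0; right; rewrite asboolT.
  move=> [wx|]; first by rewrite r_in//; exact: sub.
  by case: asboolP => // w0 /r_out ->.
have mV w : measurable [set x : R | cylinder w (V^~ x)].
  rewrite cylE rE; apply: measurableU => //.
  by case: ifP => // _; apply: measurableC.
have left_ge0 w : 0 <= left_end w.
  elim/last_ind: w => [|w s IH]; first by rewrite /left_end.
  by rewrite left_end_rcons addr_ge0// sumr_ge0// => i _; exact: coef_ge0.
have right_le1 w : left_end w + m w <= 1.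
  elim/last_ind: w => [|w s IH]; first by rewrite m_nil add0r.
  rewrite left_end_rcons; apply: le_trans IH; rewrite -addrA lerD2l.
  by have := partial_le w (pickle s).+1; rewrite partialS coef_pickle.
have PI w : uniform_prob (@ltr01 R) (word_interval w) = (m w)%:E.
  rewrite /uniform_prob (eq_integral (fun=> 1%E)); last first.
    move=> x; rewrite inE /word_interval /= => /andP[lx xr].
    rewrite /uniform_pdf ifT ?subr0 ?invr1//.
    by have := left_ge0 w; have := right_le1 w; lra.
  rewrite integral_cst ?mul1e; last exact: mI.
  rewrite itvE /= lebesgue_measure_itv /= lte_fin ltrDl.
  case: ltP (m_ge0 w) => [_ _|le ge]; first by rewrite -EFinD addrAC subrr add0r.
  by congr (_%:E); apply/eqP; rewrite eq_le le ge.
exists _, _, (uniform_prob (@ltr01 R)), V; split; first exact: mV.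
- move=> w; have cE : trajectory V @^-1` cylinder w = r @^-1` word_interval w := cylE w.
  rewrite cE rE measureU0; first exact: PI; first exact: mI.
    by case: ifP => _; [exact: (measurableC (mI _)) | exact: measurable0].
  case: ifP => [_|_]; last exact: measure0.
  apply: etrans (probability_setC (uniform_prob (@ltr01 R)) (mI [::])) _.
  rewrite [X in (1 - X)%E](_ : _ = 1%E); first by rewrite subee.
  by apply: etrans (PI [::]) _; rewrite m_nil.
- move=> x n; rewrite VE.
  have /andP[lx xr] := wordP _ n (r01 x).
  by have := le_lt_trans lx xr; rewrite ltrDl.
Qed.

End ProcessOfWordMasses.

(** * Futures of a Markov chain *)
Section MarkovLaws.
Context (S : countType) (s0 : S) (R : realType).
Implicit Types (mu : {finite_measure set (path_space s0) -> \bar R}) (w v : seq S).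

Definition markov_law mu (p : S -> S -> R) : Prop :=
  forall w a b, (mu (cylinder (rcons (rcons w a) b)) =
    mu (cylinder (rcons w a)) * (p a b)%:E)%E.

Fixpoint path_weight (p : S -> S -> R) (a : S) (v : seq S) : R :=
  if v is b :: v' then p a b * path_weight p b v' else 1.

Lemma markov_law_cat mu p w a v : markov_law mu p ->
  (mu (cylinder (rcons w a ++ v)) =
    mu (cylinder (rcons w a)) * (path_weight p a v)%:E)%E.
Proof.
move=> mup; elim: v w a => [|b v IH] w a /=; first by rewrite cats0 mule1.
by rewrite -cat_rcons IH mup EFinM muleA.
Qed.

(** The laws of the future after [w1] and after [w2], restricted to these initial
    words and not normalised, agree up to the factor [c]. *)
Definition proportional mu (w1 w2 : seq S) (c : R) : Prop :=
  forall v, (mu (cylinder (w2 ++ v)) = c%:E * mu (cylinder (w1 ++ v)))%E.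

Definition cyl_mass mu w : R := fine (mu (cylinder w)).

Lemma cyl_massE mu w : ((cyl_mass mu w)%:E = mu (cylinder w))%E.
Proof. by rewrite fineK// fin_num_measure//; exact: measurable_cylinder. Qed.

Lemma cyl_mass_ge0 mu w : 0 <= cyl_mass mu w.
Proof. exact: fine_ge0. Qed.

(** The Markov property in the only form used: up to a factor, the law of the
    future depends on the past through its last state. *)
Lemma markov_proportional mu p w1 w2 a : markov_law mu p ->
  cyl_mass mu (rcons w1 a) != 0 ->
  proportional mu (rcons w1 a) (rcons w2 a)
    (cyl_mass mu (rcons w2 a) / cyl_mass mu (rcons w1 a)).
Proof.
move=> mup n0 v; rewrite !(markov_law_cat _ _ _ mup) -!cyl_massE -!EFinM.
by congr (_%:E); field.
Qed.

Lemma proportional_rcons mu w1 w2 a c :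
  proportional mu w1 w2 c -> proportional mu (rcons w1 a) (rcons w2 a) c.
Proof. by move=> H v; rewrite !cat_rcons. Qed.

Lemma push_integral_proportional mu w1 w2 c (h : path_space s0 -> \bar R) :
  proportional mu w1 w2 c -> 0 <= c ->
  measurable_fun setT h -> (forall x, 0 <= h x)%E ->
  (push_integral mu (cylinder w2) (time_shift (size w2)) h =
   c%:E * push_integral mu (cylinder w1) (time_shift (size w1)) h)%E.
Proof.
move=> prop c0 mh h0.
have mC w := @measurable_cylinder S s0 w.
have mS n := @measurable_time_shift S s0 n.
rewrite -!(integral_restricted_pushforward _ (mC _) (mS _))//.
pose l w : {finite_measure set (path_space s0) -> \bar R} :=
  restricted_pushforward mu (mC w) (mS (size w)).
rewrite -[RHS](@ge0_integral_mscale _ _ R (l w1) _ _ (NngNum c0))//.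
apply: eq_measure_integral => D mD _.
have lE w u : l w (cylinder u) = mu (cylinder (w ++ u)) by rewrite cylinder_cat.
rewrite -[LHS]/(l w2 D); apply: path_measure_unique => //.
  by rewrite -ge0_fin_numE// fin_num_measure.
by move=> u; apply: etrans (lE w2 u) _; rewrite prop -lE.
Qed.

End MarkovLaws.

(** * The joint mass of two cylinders *)
Section GluingCylinders.
Context (A B C : countType) (R : realType) (a0 : A) (b0 : B) (c0 : C).
Variables (f : A -> C) (g : B -> C).
Variables (mu : {finite_measure set (path_space a0) -> \bar R})
  (nu : {finite_measure set (path_space b0) -> \bar R})
  (zeta : {finite_measure set (path_space c0) -> \bar R}).

Local Notation phi := (lift_path f : path_space a0 -> path_space c0).
Local Notation psi := (lift_path g : path_space b0 -> path_space c0).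
Hypothesis law_phi : forall D, measurable D -> mu (phi @^-1` D) = zeta D.
Hypothesis law_psi : forall D, measurable D -> nu (psi @^-1` D) = zeta D.

Let mphi : measurable_fun setT phi. Proof. exact: measurable_lift_path. Qed.
Let mpsi : measurable_fun setT psi. Proof. exact: measurable_lift_path. Qed.
Let mCa (w : seq A) := @measurable_cylinder A a0 w.
Let mCb (w : seq B) := @measurable_cylinder B b0 w.
Let mCc (w : seq C) := @measurable_cylinder C c0 w.

Local Notation glued_mass := (glued_mass mu nu zeta phi psi).

(** Density of the future of g(Y) after [wb] with respect to the future of Z
    after the image of [wb]. *)
Definition tail_density (wb : seq B) (k : path_space c0 -> R) : Prop :=
  is_density (push_integral nu (cylinder wb) (psi \o time_shift (size wb)))
    (push_integral zeta (cylinder (map g wb)) (time_shift (size wb))) k.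

Lemma tail_density_exists wb : exists k, tail_density wb k.
Proof.
have mb n : measurable_fun setT (psi \o (time_shift n : path_space b0 -> path_space b0)).
  by apply: measurableT_comp => //; exact: measurable_time_shift.
have mc n := @measurable_time_shift C c0 n.
apply: density_exists => // D mD.
have mG : measurable (cylinder (map g wb) `&` time_shift (size wb) @^-1` D : set (path_space c0)).
  exact: measurableI (measurable_preimage (mc _) mD).
rewrite -law_psi//; apply: le_measure; rewrite ?inE.
- exact: measurableI (measurable_preimage (mb _) mD).
- exact: measurable_preimage.
- by move=> y [wy Dy]; split => //; exact: cylinder_map.
Qed.

(** Given Z, the conditional probability that Y starts with [wb] vanishes unless
    Z starts with the image of [wb], and is then a function of the future of Z:
    [prepend] turns the defining equation of the tail density into that of the
    conditional probability. *)
Lemma glued_mass_tail_density wa wb k : map f wa = map g wb -> tail_density wb k ->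
  (glued_mass (cylinder wa) (cylinder wb) =
   push_integral mu (cylinder wa) (phi \o time_shift (size wa)) (EFin \o k))%E.
Proof.
move=> fg [mk k0 kP].
have sz : size wa = size wb by rewrite -(size_map f) fg size_map.
set G : set (path_space c0) := cylinder (map g wb).
have mk' : measurable_fun setT (k \o (time_shift (size wb) : path_space c0 -> path_space c0)).
  by apply: measurableT_comp => //; exact: measurable_time_shift.
have kC : is_cond_prob nu zeta psi (cylinder wb)
    (fun z => \1_G z * k (time_shift (size wb) z)).
  split.
  - by apply: measurable_funM => //; apply: measurable_indic; exact: mCc.
  - by move=> z; rewrite mulr_ge0// indicE.
  move=> h mh h0.
  have mh' : measurable_fun setT (h \o (prepend (map g wb) : path_space c0 -> path_space c0)).
    by apply: measurableT_comp => //; exact: measurable_prepend.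
  transitivity (push_integral nu (cylinder wb) (psi \o time_shift (size wb))
      (h \o prepend (map g wb))).
    apply: eq_integral => y; rewrite inE => /(cylinder_map g) wy /=.
    by rewrite -[in LHS](prepend_shift wy) size_map.
  rewrite kP//; last by move=> u; exact: h0.
  rewrite /push_integral [LHS]integral_mkcond; apply: eq_integral => z _.
  rewrite patchE indicE -/G; case: ifPn => [|_]; last by rewrite mul0r mule0.
  rewrite inE => Gz; rewrite mul1r /=.
  by have := prepend_shift Gz; rewrite size_map => ->.
rewrite (glued_mass_density mphi mpsi law_phi law_psi _ _ kC)//.
apply: eq_integral => x; rewrite inE => wx /=.
by rewrite indicE mem_set ?mul1r ?sz// /G -fg; exact: cylinder_map.
Qed.

(** The formula P(a) P(b) / P(c) * K for the joint mass, in ratio form.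
    Scaling the future of Y by [sb] and that of Z by [sc] scales the tail density
    by [sb / sc]; its integral is taken over the future of X, which gives [sa]. *)
Lemma glued_mass_proportional wa wb wa' wb' sa sb sc :
  map f wa = map g wb -> map f wa' = map g wb' ->
  0 <= sa -> 0 <= sb -> 0 < sc ->
  proportional mu wa wa' sa -> proportional nu wb wb' sb ->
  proportional zeta (map g wb) (map g wb') sc ->
  (glued_mass (cylinder wa') (cylinder wb') =
   (sa * sb / sc)%:E * glued_mass (cylinder wa) (cylinder wb))%E.
Proof.
move=> fg fg' sa0 sb0 sc0 pa pb pc.
have mt n := @measurable_time_shift C c0 n.
have ma n := @measurable_time_shift A a0 n.
have [k kwb] := tail_density_exists wb; have [mk k0 kP] := kwb.
have mk' : measurable_fun setT (fun u => sb / sc * k u) by apply: measurable_funM.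
have k'0 u : 0 <= sb / sc * k u by rewrite mulr_ge0// divr_ge0// ltW.
have kwb' : tail_density wb' (fun u => sb / sc * k u).
  split => // h mh h0.
  rewrite -[LHS]/(push_integral nu (cylinder wb') (time_shift (size wb')) (h \o psi)).
  rewrite (push_integral_proportional pb)//; first last.
  - by move=> x; exact: h0.
  - exact: (measurableT_comp mh mpsi).
  rewrite -[X in (_ * X)%E]/(push_integral nu (cylinder wb) (psi \o time_shift (size wb)) h) kP//.
  rewrite -(size_map g wb') (push_integral_proportional pc) ?ltW//; first last.
  - by move=> u; rewrite mule_ge0// lee_fin.
  - by apply: emeasurable_funM => //; exact/measurable_EFinP.
  rewrite size_map /push_integral.
  under [in RHS]eq_integral do rewrite EFinM muleCA.
  rewrite ge0_integralZl//; first last.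
  - by rewrite lee_fin divr_ge0// ltW.
  - by move=> x _; rewrite mule_ge0// lee_fin.
  - apply/measurable_funTS/emeasurable_funM; first exact: (measurableT_comp mh (mt _)).
    by apply/measurable_EFinP; exact: (measurableT_comp mk (mt _)).
  - rewrite muleA -EFinM; congr (_%:E * _)%E.
    by rewrite mulrCA divff ?mulr1// gt_eqF.
rewrite (glued_mass_tail_density fg' kwb') (glued_mass_tail_density fg kwb).
rewrite -[LHS]/(push_integral mu (cylinder wa') (time_shift (size wa'))
  (fun x => (sb / sc * k (phi x))%:E)).
rewrite (push_integral_proportional pa)//; first last.
- by move=> x; rewrite lee_fin.
- by apply/measurable_EFinP; exact: (measurableT_comp mk' mphi).
rewrite /push_integral.
under [in LHS]eq_integral do rewrite EFinM.
rewrite ge0_integralZl//; first last.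
- by rewrite lee_fin divr_ge0// ltW.
- by move=> x _; rewrite lee_fin.
- apply/measurable_funTS/measurable_EFinP.
  exact: (measurableT_comp mk (measurableT_comp mphi (ma _))).
by rewrite muleA -EFinM mulrA.
Qed.

End GluingCylinders.

(** * Markov chains from word masses *)
Section MarkovOfMasses.
Context (S : countType) (R : realType).
Variable m : seq S -> R.
Hypotheses (m_ge0 : forall w, 0 <= m w).
Hypothesis m_rcons : forall w,
  (\esum_(s in [set: S]) (m (rcons w s))%:E = (m w)%:E)%E.
Hypothesis m_ratio : forall w1 w2 s s', 0 < m (rcons w1 s) -> 0 < m (rcons w2 s) ->
  m (rcons (rcons w1 s) s') / m (rcons w1 s) =
  m (rcons (rcons w2 s) s') / m (rcons w2 s).

(** At a state that no word of positive mass reaches, the chain stays put, so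
    that the matrix is stochastic everywhere. *)
Definition mass_transition (s s' : S) : R :=
  if pselect (exists w, 0 < m (rcons w s)) is left ex then
    m (rcons (rcons (sval (cid ex)) s) s') / m (rcons (sval (cid ex)) s)
  else (s == s')%:R.

Lemma mass_transitionE w s s' : 0 < m (rcons w s) ->
  m (rcons (rcons w s) s') / m (rcons w s) = mass_transition s s'.
Proof.
move=> ws; rewrite /mass_transition; case: pselect => [ex|]; last by case; exists w.
by apply: m_ratio => //; case: cid.
Qed.

Lemma stochastic_mass_transition : stochastic_matrix mass_transition.
Proof.
split=> [s s'|s]; rewrite /mass_transition; case: pselect => [ex|_].
- by rewrite divr_ge0.
- exact: ler0n.
- case: cid => w /= ws; rewrite esum_enumeration; last first.
    by move=> s'; rewrite lee_fin divr_ge0.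
  transitivity (\sum_(n <oo) (((m (rcons w s))^-1)%:E *
      oapp (fun s' => (m (rcons (rcons w s) s'))%:E) 0 (pickle_inv n)))%E.
    apply: eq_eseriesr => n _.
    by case: pickle_inv => [s'|] /=; rewrite ?mule0// -EFinM mulrC.
  rewrite nneseriesZl; last first.
    by move=> n _; case: pickle_inv => [s'|] //=; rewrite lee_fin.
  rewrite -esum_enumeration; last by move=> s'; rewrite lee_fin.
  by rewrite m_rcons -EFinM mulVf// gt_eqF.
- transitivity (\esum_(s' in [set s]) (1 : \bar R))%E; last by rewrite esum_set1.
  rewrite [RHS]esum_mkcond; apply: eq_esum => s' _.
  by rewrite classical_sets.in_set1 eq_sym; case: eqP.
Qed.

Lemma history_cylinder d (T : measurableType d) (X : nat -> T -> S) t x :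
  history X t x = trajectory X @^-1` cylinder (mkseq x t.+1).
Proof.
have cylE w : cylinder (mkseq x t.+1) (trajectory X w) =
    (mkseq (trajectory X w) t.+1 = mkseq x t.+1).
  by rewrite {1}/cylinder /mkset size_mkseq.
apply/seteqP; split => w; rewrite /preimage {1}/mkset ?cylE /history; last first.
  move=> H s st.
  have := congr1 (fun l => nth (x 0%N) l s) H.
  by rewrite !nth_mkseq// ltnS.
move=> H; apply/eq_in_map => s.
by rewrite mem_iota add0n => /H.
Qed.

Lemma markov_of_masses d (Omega : measurableType d) (P : probability Omega R)
    (V : nat -> Omega -> S) :
  is_process V -> (forall w, P (trajectory V @^-1` cylinder w) = (m w)%:E) ->
  homogeneous_markov_chain P V.
Proof.
move=> pV PV; split => //; exists mass_transition; split.
  exact: stochastic_mass_transition.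
move=> t x b; rewrite history_cylinder /elementary_cond_prob.
have -> : V t.+1 @^-1` [set b] `&` trajectory V @^-1` cylinder (mkseq x t.+1) =
    trajectory V @^-1` cylinder (rcons (mkseq x t.+1) b).
  by rewrite cylinder_rcons preimage_setI setIC size_mkseq.
have -> : mkseq x t.+1 = rcons (mkseq x t) (x t).
  by rewrite /mkseq -addn1 iotaD map_cat /= add0n cats1.
rewrite !PV /= eqe => n0; rewrite mass_transitionE//.
by rewrite lt_neqAle eq_sym n0 m_ge0.
Qed.

End MarkovOfMasses.

(** * Word masses of the pair *)
Section PairMass.
Context (A B C : countType) (R : realType) (a0 : A) (b0 : B) (c0 : C).
Variables (f : A -> C) (g : B -> C).
Variables (mu : {finite_measure set (path_space a0) -> \bar R})
  (nu : {finite_measure set (path_space b0) -> \bar R})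
  (zeta : {finite_measure set (path_space c0) -> \bar R}).
Local Notation phi := (lift_path f : path_space a0 -> path_space c0).
Local Notation psi := (lift_path g : path_space b0 -> path_space c0).
Hypothesis law_phi : forall D, measurable D -> mu (phi @^-1` D) = zeta D.
Hypothesis law_psi : forall D, measurable D -> nu (psi @^-1` D) = zeta D.

Let mphi : measurable_fun setT phi. Proof. exact: measurable_lift_path. Qed.
Let mpsi : measurable_fun setT psi. Proof. exact: measurable_lift_path. Qed.
Let mCa (w : seq A) := @measurable_cylinder A a0 w.
Let mCb (w : seq B) := @measurable_cylinder B b0 w.
Let mCc (w : seq C) := @measurable_cylinder C c0 w.

Local Notation glued_mass := (glued_mass mu nu zeta phi psi).

Definition pair_mass (w : seq (A * B)) : R :=
  fine (glued_mass (cylinder (unzip1 w)) (cylinder (unzip2 w))).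

Lemma pair_massE w : ((pair_mass w)%:E =
  glued_mass (cylinder (unzip1 w)) (cylinder (unzip2 w)))%E.
Proof. by rewrite fineK// (glued_mass_fin mphi mpsi law_phi law_psi). Qed.

Lemma pair_mass_ge0 w : 0 <= pair_mass w.
Proof. by apply: fine_ge0; exact: (glued_mass_ge0 mu _ mpsi law_psi). Qed.

Lemma glued_mass_rcons_l wa F : measurable F ->
  (glued_mass (cylinder wa) F =
   \esum_(a in [set: A]) glued_mass (cylinder (rcons wa a)) F)%E.
Proof.
move=> mF; have [M MP] := glued_mass_measure_l mu mphi mpsi law_psi mF.
rewrite -MP (@measure_fibres _ (path_space a0) A R M (fun x => x (size wa)))//.
  by apply: eq_esum => a _; rewrite MP cylinder_rcons.
by move=> a; exact: measurable_coordinate.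
Qed.

Lemma glued_mass_rcons_r E wb : measurable E ->
  (glued_mass E (cylinder wb) =
   \esum_(b in [set: B]) glued_mass E (cylinder (rcons wb b)))%E.
Proof.
move=> mE; have [M MP] := glued_mass_measure_r mphi mpsi law_phi law_psi mE.
rewrite -MP// (@measure_fibres _ (path_space b0) B R M (fun x => x (size wb)))//.
  by apply: eq_esum => b _; rewrite -MP// cylinder_rcons.
by move=> a; exact: measurable_coordinate.
Qed.

Lemma pair_mass_rcons w :
  (\esum_(s in [set: A * B]) (pair_mass (rcons w s))%:E = (pair_mass w)%:E)%E.
Proof.
rewrite [RHS]pair_massE glued_mass_rcons_l//.
under [RHS]eq_esum do rewrite glued_mass_rcons_r//.
rewrite esum_esum; last by move=> a b _ _; exact: (glued_mass_ge0 mu _ mpsi law_psi).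
rewrite (_ : _ `*`` _ = setT); last by apply/seteqP; split.
by apply: eq_esum => -[a b] _; rewrite pair_massE /unzip1 /unzip2 !map_rcons.
Qed.

(** Two words with different images force the common image process into disjoint
    cylinders, and the joint mass is bounded by both marginals. *)
Lemma pair_mass_support w : pair_mass w != 0 ->
  [/\ map f (unzip1 w) = map g (unzip2 w), cyl_mass mu (unzip1 w) != 0
    & cyl_mass nu (unzip2 w) != 0].
Proof.
move=> w0; split.
- apply: contra_neqP w0 => fg; rewrite /pair_mass.
  rewrite (glued_mass_disjoint mphi mpsi law_phi law_psi
    (D1 := cylinder (map f (unzip1 w))) (D2 := cylinder (map g (unzip2 w))))//.
  + by move=> x; exact: cylinder_map.
  + by move=> x; exact: cylinder_map.
  + by apply: cylinder_disjoint => //; rewrite !size_map.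
- apply: contra_neq w0 => w0; apply/eqP; rewrite eq_le pair_mass_ge0 andbT.
  by rewrite -lee_fin pair_massE -w0 cyl_massE (glued_mass_le_l mphi mpsi law_phi law_psi).
- apply: contra_neq w0 => w0; apply/eqP; rewrite eq_le pair_mass_ge0 andbT.
  by rewrite -lee_fin pair_massE -w0 cyl_massE (glued_mass_le_r mphi mpsi law_phi law_psi).
Qed.

Lemma pair_mass_proportional w w' sa sb sc :
  map f (unzip1 w) = map g (unzip2 w) -> map f (unzip1 w') = map g (unzip2 w') ->
  0 <= sa -> 0 <= sb -> 0 < sc ->
  proportional mu (unzip1 w) (unzip1 w') sa ->
  proportional nu (unzip2 w) (unzip2 w') sb ->
  proportional zeta (map g (unzip2 w)) (map g (unzip2 w')) sc ->
  pair_mass w' = sa * sb / sc * pair_mass w.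
Proof.
move=> fg fg' sa0 sb0 sc0 pa pb pc; apply: EFin_inj.
rewrite EFinM [LHS]pair_massE [X in (_ * X)%E]pair_massE.
exact: (glued_mass_proportional law_phi law_psi).
Qed.

Section Homogeneity.
Variables (p : A -> A -> R) (q : B -> B -> R) (r : C -> C -> R).
Hypotheses (mup : markov_law mu p) (nuq : markov_law nu q) (zetar : markov_law zeta r).

Let image_mass_neq0 wb : cyl_mass nu wb != 0 -> cyl_mass zeta (map g wb) != 0.
Proof.
apply: contra_neq => z0; apply/eqP; rewrite eq_le cyl_mass_ge0 andbT.
rewrite -lee_fin -z0 !cyl_massE -law_psi//; apply: le_measure; rewrite ?inE//.
  exact: measurable_preimage.
by move=> x; exact: cylinder_map.
Qed.

(** Passing from [w1] to [w2] multiplies the joint mass by one and the same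
    factor before and after the extra step [s'], since a factor of
    proportionality of the futures survives any common extension. *)
Lemma pair_mass_ratio w1 w2 s s' :
  0 < pair_mass (rcons w1 s) -> 0 < pair_mass (rcons w2 s) ->
  pair_mass (rcons (rcons w1 s) s') / pair_mass (rcons w1 s) =
  pair_mass (rcons (rcons w2 s) s') / pair_mass (rcons w2 s).
Proof.
case: s s' => a b [a' b'] m1 m2.
have rcE (T1 T2 : Type) (w : seq (T1 * T2)) x y :
    (unzip1 (rcons w (x, y)) = rcons (unzip1 w) x) *
    (unzip2 (rcons w (x, y)) = rcons (unzip2 w) y).
  by rewrite /unzip1 /unzip2 !map_rcons.
have := pair_mass_support (lt0r_neq0 m1); have := pair_mass_support (lt0r_neq0 m2).
rewrite !rcE => -[fg2 a2 b2] [fg1 a1 b1].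
have c1 := image_mass_neq0 b1; have c2 := image_mass_neq0 b2.
have pa := markov_proportional (unzip1 w2) mup a1.
have pb := markov_proportional (unzip2 w2) nuq b1.
have pc : proportional zeta (map g (rcons (unzip2 w1) b)) (map g (rcons (unzip2 w2) b))
    (cyl_mass zeta (map g (rcons (unzip2 w2) b)) /
     cyl_mass zeta (map g (rcons (unzip2 w1) b))).
  by move: c1; rewrite !map_rcons; exact: markov_proportional.
move: pa pb pc.
set sa := (_ / _); set sb := (_ / _); set sc := (_ / _) => pa pb pc.
have gt0 (T : countType) (t0 : T) (la : {finite_measure set (path_space t0) -> \bar R}) w w' :
    cyl_mass la w != 0 -> cyl_mass la w' != 0 -> 0 < cyl_mass la w / cyl_mass la w'.
  by move=> w0 w'0; rewrite divr_gt0// lt_neqAle eq_sym ?w0 ?w'0 cyl_mass_ge0.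
have sa0 : 0 < sa by exact: gt0.
have sb0 : 0 < sb by exact: gt0.
have sc0 : 0 < sc by exact: gt0.
have m21 : pair_mass (rcons w2 (a, b)) = sa * sb / sc * pair_mass (rcons w1 (a, b)).
  by apply: pair_mass_proportional; rewrite ?rcE ?ltW.
suff m21' : pair_mass (rcons (rcons w2 (a, b)) (a', b')) =
    sa * sb / sc * pair_mass (rcons (rcons w1 (a, b)) (a', b')).
  rewrite m21' m21 -mulf_div divff ?mul1r//.
  by apply: lt0r_neq0; apply: divr_gt0 => //; exact: mulr_gt0.
(* If the new letters have different images, both extended masses vanish. *)
have [fg'|fg'] := eqVneq (f a') (g b').
  apply: pair_mass_proportional; rewrite ?rcE ?ltW//.
  - by rewrite [LHS]map_rcons fg1 fg' -map_rcons.
  - by rewrite [LHS]map_rcons fg2 fg' -map_rcons.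
  - exact: proportional_rcons.
  - exact: proportional_rcons.
  - by rewrite !(map_rcons _ (rcons _ _)); exact: proportional_rcons.
have null w : pair_mass (rcons w (a', b')) = 0.
  apply: contra_neq_eq fg' => /pair_mass_support[].
  by rewrite !rcE !map_rcons => /rcons_inj[].
by rewrite !null mulr0.
Qed.

End Homogeneity.

End PairMass.

(** * Laws of processes *)
Section ProcessLaw.
Context d (Omega : measurableType d) (R : realType) (S : countType) (s0 : S).
Variables (P : probability Omega R) (X : nat -> Omega -> S).

Lemma measurable_trajectory : is_process X ->
  measurable_fun setT (trajectory X : Omega -> path_space s0).
Proof. by move=> pX; apply: measurable_to_path => t a; exact: pX. Qed.

Lemma process_of_cylinders :
  (forall w, measurable (trajectory X @^-1` cylinder w)) -> is_process X.
Proof.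
move=> mX t a.
have mtX : measurable_fun setT (trajectory X : Omega -> path_space s0).
  apply: measurability; first exact: generated_by_cylinders.
  by move=> _ [_ [->|[w ->]] <-]; rewrite setTI ?preimage_set0.
exact: (measurable_preimage mtX (@measurable_coordinate S s0 t a)).
Qed.

Definition process_law (mX : measurable_fun setT (trajectory X : Omega -> path_space s0)) :
  {finite_measure set (path_space s0) -> \bar R} :=
  restricted_pushforward P measurableT mX.

Lemma process_lawE mX D : process_law mX D = P (trajectory X @^-1` D).
Proof. by rewrite /process_law /= /restricted_pushforward setTI. Qed.

Lemma markov_process_law mX : homogeneous_markov_chain P X ->
  exists p, markov_law (process_law mX) p.
Proof.
move=> [pX [p [_ Xp]]]; exists p => w a b; rewrite !process_lawE.
pose x := nth a (rcons w a).
have xw : mkseq x (size w).+1 = rcons w a.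
  by rewrite -[X in mkseq _ X](size_rcons w a) mkseq_nth.
have mC v : measurable (trajectory X @^-1` cylinder v).
  exact: (measurable_preimage mX (@measurable_cylinder _ s0 v)).
have fC v : P (trajectory X @^-1` cylinder v) \is a fin_num by exact: fin_num_measure.
have step : trajectory X @^-1` cylinder (rcons (rcons w a) b) =
    X (size w).+1 @^-1` [set b] `&` trajectory X @^-1` cylinder (rcons w a).
  by rewrite [in LHS]cylinder_rcons preimage_setI setIC size_rcons.
have [P0|P0] := eqVneq (P (trajectory X @^-1` cylinder (rcons w a))) 0%E.
  rewrite P0 mul0e; apply/eqP; rewrite eq_le measure_ge0 andbT -P0 step.
  by apply: le_measure; rewrite ?inE// -?step.
have := Xp (size w) x b; rewrite history_cylinder xw => /(_ P0).
rewrite /elementary_cond_prob -step /x nth_rcons ltnn eqxx => <-.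
rewrite -[X in (X * _)%E]fineK// -EFinM mulrC divfK ?fineK//.
by rewrite -eqe fineK.
Qed.

End ProcessLaw.

(** * The joint law of the coupled processes *)
Section JointLaw.
Context (A B C : countType) (R : realType) (a0 : A) (b0 : B) (c0 : C).
Variables (f : A -> C) (g : B -> C).
Variables (mu : {finite_measure set (path_space a0) -> \bar R})
  (nu : {finite_measure set (path_space b0) -> \bar R})
  (zeta : {finite_measure set (path_space c0) -> \bar R}).
Local Notation phi := (lift_path f : path_space a0 -> path_space c0).
Local Notation psi := (lift_path g : path_space b0 -> path_space c0).
Hypothesis law_phi : forall D, measurable D -> mu (phi @^-1` D) = zeta D.
Hypothesis law_psi : forall D, measurable D -> nu (psi @^-1` D) = zeta D.

Let mphi : measurable_fun setT phi. Proof. exact: measurable_lift_path. Qed.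
Let mpsi : measurable_fun setT psi. Proof. exact: measurable_lift_path. Qed.
Let mCa (w : seq A) := @measurable_cylinder A a0 w.
Let mCb (w : seq B) := @measurable_cylinder B b0 w.

Context d (Omega : measurableType d) (P : probability Omega R).
Variables (X : nat -> Omega -> A) (Y : nat -> Omega -> B).
Hypotheses (pX : is_process X) (pY : is_process Y).
Hypothesis PXY : forall w, P (trajectory (fun t x => (X t x, Y t x)) @^-1` cylinder w) =
  (pair_mass f g mu nu zeta w)%:E.

Let mX := measurable_trajectory (s0 := a0) pX.
Let mY := measurable_trajectory (s0 := b0) pY.
Let mXE E (mE : @measurable _ (path_space a0) E) := measurable_preimage mX mE.
Let mYF F (mF : @measurable _ (path_space b0) F) := measurable_preimage mY mF.

Local Notation glued_mass := (glued_mass mu nu zeta phi psi).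

(** For words of the same length the event is a cylinder of the pair.  In
    general, the shorter word is extended letter by letter, which uses additivity
    of both sides; the induction is on the difference of the lengths. *)
Lemma joint_law_cylinders u v :
  P (trajectory X @^-1` cylinder u `&` trajectory Y @^-1` cylinder v) =
  glued_mass (cylinder u) (cylinder v).
Proof.
have [n] := ubnP ((size u - size v) + (size v - size u)).
elim: n => // n IH in u v *; rewrite ltnS => uvn.
have [lt|lt|eq] := ltngtP (size u) (size v).
- rewrite (glued_mass_rcons_l f mu law_psi)//.
  rewrite (measure_fibres P (V := X (size u)))//; last first.
    by apply: measurableI; [exact: mXE | exact: mYF].
  apply: eq_esum => a _; rewrite -IH; last by rewrite size_rcons; lia.
  by congr (P _); rewrite cylinder_rcons preimage_setI setIAC.
- rewrite (glued_mass_rcons_r law_phi law_psi)//.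
  rewrite (measure_fibres P (V := Y (size v)))//; last first.
    by apply: measurableI; [exact: mXE | exact: mYF].
  apply: eq_esum => b _; rewrite -IH; last by rewrite size_rcons; lia.
  by congr (P _); rewrite cylinder_rcons preimage_setI setIA.
have u1 : unzip1 (zip u v) = u by rewrite unzip1_zip ?eq.
have v2 : unzip2 (zip u v) = v by rewrite unzip2_zip ?eq.
rewrite -[in RHS]u1 -[X in glued_mass _ (cylinder X)]v2.
rewrite -(pair_massE law_phi law_psi) -PXY; congr (P _).
by rewrite cylinder_pair u1 v2.
Qed.

(** The pi-lambda extension, in the first event with the second one a cylinder,
    and then in the second event. *)
Lemma joint_law E F : @measurable _ (path_space a0) E -> @measurable _ (path_space b0) F ->
  P (trajectory X @^-1` E `&` trajectory Y @^-1` F) = glued_mass E F.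
Proof.
move=> mE mF.
have cyl v : P (trajectory X @^-1` E `&` trajectory Y @^-1` cylinder v) =
    glued_mass E (cylinder v).
  have [M MP] := glued_mass_measure_l mu mphi mpsi law_psi (mCb v).
  rewrite -MP setIC.
  apply: (@path_measure_unique _ _ _
    (restricted_pushforward P (mYF (mCb v)) mX) M) => //.
    by rewrite -ge0_fin_numE// fin_num_measure.
  by move=> w; rewrite MP -joint_law_cylinders setIC.
have [M MP] := glued_mass_measure_r mphi mpsi law_phi law_psi mE.
rewrite -MP//.
apply: (@path_measure_unique _ _ _ (restricted_pushforward P (mXE mE) mY) M) => //.
  by rewrite -ge0_fin_numE// fin_num_measure.
by move=> w; rewrite MP// -cyl.
Qed.

End JointLaw.

(** * Conditional independence *)
Section ConditionalIndependence.
Context (A B C : countType) (R : realType) (a0 : A) (b0 : B) (c0 : C).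
Variables (f : A -> C) (g : B -> C).
Variables (mu : {finite_measure set (path_space a0) -> \bar R})
  (nu : {finite_measure set (path_space b0) -> \bar R})
  (zeta : {finite_measure set (path_space c0) -> \bar R}).
Local Notation phi := (lift_path f : path_space a0 -> path_space c0).
Local Notation psi := (lift_path g : path_space b0 -> path_space c0).
Hypothesis law_phi : forall D, measurable D -> mu (phi @^-1` D) = zeta D.
Hypothesis law_psi : forall D, measurable D -> nu (psi @^-1` D) = zeta D.

Let mphi : measurable_fun setT phi. Proof. exact: measurable_lift_path. Qed.
Let mpsi : measurable_fun setT psi. Proof. exact: measurable_lift_path. Qed.

Context d (Omega : measurableType d) (P : probability Omega R).
Variables (X : nat -> Omega -> A) (Y : nat -> Omega -> B).
Hypotheses (pX : is_process X) (pY : is_process Y).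
Hypothesis fXgY : forall t x, f (X t x) = g (Y t x).
Hypothesis joint : forall E F, @measurable _ (path_space a0) E ->
  @measurable _ (path_space b0) F ->
  P (trajectory X @^-1` E `&` trajectory Y @^-1` F) =
  glued_mass mu nu zeta phi psi E F.

Let Z t x := f (X t x).
Let mX := measurable_trajectory (s0 := a0) pX.

Lemma marginal_l E : @measurable _ (path_space a0) E ->
  P (trajectory X @^-1` E) = mu E.
Proof.
move=> mE; rewrite -(glued_mass_setTr mphi mpsi law_phi law_psi mE) -joint//.
by rewrite preimage_setT setIT.
Qed.

Lemma marginal_r F : @measurable _ (path_space b0) F ->
  P (trajectory Y @^-1` F) = nu F.
Proof.
move=> mF; rewrite -(glued_mass_setTl mphi mpsi law_phi law_psi mF) -joint//.
by rewrite preimage_setT setTI.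
Qed.

Let mZ : measurable_fun setT (trajectory Z : Omega -> path_space c0).
Proof. exact: (measurableT_comp mphi mX). Qed.

Let law_Z D : @measurable _ (path_space c0) D -> P (trajectory Z @^-1` D) = zeta D.
Proof.
by move=> mD; rewrite -law_phi// -marginal_l//; exact: measurable_preimage.
Qed.

Lemma integral_over_Z (k : path_space c0 -> R) D :
  measurable_fun setT k -> (forall z, 0 <= k z) -> @measurable _ (path_space c0) D ->
  (\int[P]_(x in trajectory Z @^-1` D) (k (trajectory Z x))%:E =
   \int[zeta]_(z in D) (k z)%:E)%E.
Proof.
move=> mk k0 mD.
transitivity (\int[pushforward P (trajectory Z : Omega -> path_space c0)]_(z in D) (k z)%:E)%E.
  rewrite ge0_integral_pushforward//; first by apply/measurable_funTS/measurable_EFinP.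
  by move=> z _; rewrite lee_fin.
by apply: eq_measure_integral => E mE _; exact: law_Z.
Qed.

(** A density on the paths of Z, composed with Z, is measurable for the
    sigma-algebra of Z, and the change of variables along Z turns its integrals
    into integrals over the sample space. *)
Lemma cond_prob_version_of_density G (k : path_space c0 -> R) :
  measurable G ->
  measurable_fun setT k -> (forall z, 0 <= k z) ->
  (forall D, @measurable _ (path_space c0) D ->
     \int[zeta]_(z in D) (k z)%:E = P (G `&` trajectory Z @^-1` D))%E ->
  cond_prob_version P (process_sigma Z) G (fun x => k (trajectory Z x)).
Proof.
move=> mG mk k0 kG.
have mkZ : measurable_fun setT (fun x => k (trajectory Z x)) by exact: (measurableT_comp mk mZ).
have version D : @measurable _ (path_space c0) D ->
    (\int[P]_(x in trajectory Z @^-1` D) (k (trajectory Z x))%:E =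
     P (G `&` trajectory Z @^-1` D))%E.
  by move=> mD; rewrite integral_over_Z// kG.
split.
- move=> E mE; exists (k @^-1` E); last by rewrite setTI.
  exact: (measurable_preimage mk mE).
- apply/integrableP; split; first exact/measurable_EFinP.
  under eq_integral do rewrite /= ger0_norm//.
  have := version _ measurableT; rewrite preimage_setT setIT => ->.
  by rewrite -ge0_fin_numE// fin_num_measure.
- by move=> _ [D mD <-]; rewrite setTI; exact: version.
Qed.

Lemma cond_independent_of_joint_law : cond_independent_given P X Y Z.
Proof.
move=> _ _ [E mE <-] [F mF <-]; rewrite !setTI.
have mXE := measurable_preimage mX mE.
have mYF := measurable_preimage (measurable_trajectory (s0 := b0) pY) mF.
pose kE := cond_prob mu zeta phi E; pose kF := cond_prob nu zeta psi F.
have mkE : measurable_fun setT kE := measurable_cond_prob mphi law_phi mE.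
have mkF : measurable_fun setT kF := measurable_cond_prob mpsi law_psi mF.
have kE0 z : 0 <= kE z := cond_prob_ge0 mphi law_phi z mE.
have kF0 z : 0 <= kF z := cond_prob_ge0 mpsi law_psi z mF.
have ZY : Z = (fun t x => g (Y t x)) by apply/funext => t; apply/funext => x; exact: fXgY.
exists (fun x => kE (trajectory Z x)), (fun x => kF (trajectory Z x)),
  (fun x => kE (trajectory Z x) * kF (trajectory Z x)); split.
- apply: cond_prob_version_of_density => // D mD.
  rewrite (integral_cond_prob_set mphi law_phi)// -marginal_l//.
  by apply: measurableI => //; exact: measurable_preimage.
- apply: cond_prob_version_of_density => // D mD.
  rewrite (integral_cond_prob_set mpsi law_psi)// -marginal_r ?ZY//.
  by apply: measurableI => //; exact: measurable_preimage.
- apply: (cond_prob_version_of_density (k := fun z => kE z * kF z)) => //.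
  + exact: measurableI.
  + exact: measurable_funM.
  + by move=> z; rewrite mulr_ge0.
  move=> D mD.
  rewrite -(glued_mass_fibre mphi mpsi law_phi law_psi)//.
  rewrite -joint//; last by apply: measurableI => //; exact: measurable_preimage.
  by rewrite preimage_setI setIAC.
- exact: aeW.
Qed.

End ConditionalIndependence.

(** * The coupling *)
Theorem theorem1 (R : realType) (A B C : countType)
  (dX : measure_display) (OmegaX : measurableType dX)
  (PX : probability OmegaX R) (Xbar : nat -> OmegaX -> A)
  (dY : measure_display) (OmegaY : measurableType dY)
  (PY : probability OmegaY R) (Ybar : nat -> OmegaY -> B)
  (dZ : measure_display) (OmegaZ : measurableType dZ)
  (PZ : probability OmegaZ R) (Zbar : nat -> OmegaZ -> C)
  (f : A -> C) (g : B -> C)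
  (markovX : homogeneous_markov_chain PX Xbar)
  (markovY : homogeneous_markov_chain PY Ybar)
  (markovZ : homogeneous_markov_chain PZ Zbar)
  (lawX : eq_law PX (fun t w => f (Xbar t w)) PZ Zbar)
  (lawY : eq_law PZ Zbar PY (fun t w => g (Ybar t w))) :
  exists (d : measure_display) (Omega : measurableType d)
         (P : probability Omega R)
         (X : nat -> Omega -> A) (Y : nat -> Omega -> B),
    homogeneous_markov_chain P (fun t w => (X t w, Y t w)) /\
    eq_law P X PX Xbar /\
    eq_law P Y PY Ybar /\
    (forall (t : nat) (w : Omega), f (X t w) = g (Y t w)) /\
    eq_law P (fun t w => f (X t w)) PZ Zbar /\
    cond_independent_given P X Y (fun t w => f (X t w)).
Proof.
(* The sample spaces are nonempty, which supplies base points for the path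
   spaces. *)
pose a0 := Xbar 0%N point; pose b0 := Ybar 0%N point; pose c0 := Zbar 0%N point.
have mX := measurable_trajectory (s0 := a0) markovX.1.
have mY := measurable_trajectory (s0 := b0) markovY.1.
have mZ := measurable_trajectory (s0 := c0) markovZ.1.
pose mu := process_law PX mX; pose nu := process_law PY mY.
pose zeta := process_law PZ mZ.
pose phi : path_space a0 -> path_space c0 := lift_path f.
pose psi : path_space b0 -> path_space c0 := lift_path g.
have law_phi D : @measurable _ (path_space c0) D -> mu (phi @^-1` D) = zeta D.
  by move=> mD; rewrite !process_lawE -lawX.
have law_psi D : @measurable _ (path_space c0) D -> nu (psi @^-1` D) = zeta D.
  by move=> mD; rewrite !process_lawE lawY.
have [p mup] := markov_process_law mX markovX.
have [q nuq] := markov_process_law mY markovY.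
have [r zetar] := markov_process_law mZ markovZ.
pose m := pair_mass f g mu nu zeta.
have m0 w : 0 <= m w by exact: (pair_mass_ge0 f mu law_psi).
have m_nil : m [::] = 1.
  apply: EFin_inj; rewrite pair_massE// !cylinder_nil.
  rewrite (glued_mass_setTr (@measurable_lift_path _ _ a0 c0 f) (@measurable_lift_path _ _ b0 c0 g))//.
  by rewrite process_lawE preimage_setT probability_setT.
have m_rcons w : (\esum_(s in [set: A * B]) (m (rcons w s))%:E = (m w)%:E)%E.
  exact: pair_mass_rcons.
have [d [Om [P [V [mV PV Vpos]]]]] := process_of_word_masses m0 m_nil m_rcons.
pose X t x := (V t x).1; pose Y t x := (V t x).2.
have VXY : V = fun t x => (X t x, Y t x).
  by apply/funext => t; apply/funext => x; rewrite /X /Y; case: (V t x).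
have pV : is_process V by apply: (process_of_cylinders (a0, b0)).
have pX : is_process X.
  move=> t a; exact: (@measurable_countable_preimage _ _ _ (V t) (fst @^-1` [set a])).
have pY : is_process Y.
  move=> t b; exact: (@measurable_countable_preimage _ _ _ (V t) (snd @^-1` [set b])).
have fXgY t x : f (X t x) = g (Y t x).
  have [fgV _ _] := pair_mass_support law_phi law_psi (lt0r_neq0 (Vpos x t.+1)).
  move: fgV; rewrite /unzip1 /unzip2 /mkseq -!map_comp => /eq_in_map; apply.
  by rewrite mem_iota ltnS leqnn.
have PXY w : P (trajectory (fun t x => (X t x, Y t x)) @^-1` cylinder w) = (m w)%:E.
  by rewrite -VXY PV.
have joint := joint_law law_phi law_psi pX pY PXY.
exists d, Om, P, X, Y; split.
  rewrite -VXY; apply: (markov_of_masses (m := m) m0 m_rcons _ pV PV).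
  exact: (pair_mass_ratio law_phi law_psi mup nuq zetar).
have lX : eq_law P X PX Xbar.
  move=> E mE.
  by rewrite (marginal_l law_phi law_psi joint mE) process_lawE.
split => //; split.
  by move=> F mF; rewrite (marginal_r law_phi law_psi joint mF) process_lawE.
split => //; split.
  move=> D mD; rewrite -lawX//.
  have mphiD : path_events (phi @^-1` D).
    exact: (measurable_preimage (@measurable_lift_path _ _ a0 c0 f) mD).
  exact: (lX _ mphiD).
exact: (cond_independent_of_joint_law law_phi law_psi).
Qed.
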